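(* Let $b \ge 2$ be an integer. There exists an effective real constant $C_b$, depending only on $b$, such that for every $\gamma \in \mathbb{R}$ and every integer $N \ge 2$, $$\min_{1 \leq n \leq N,\ n \in \mathfrak{D}_{b}} \|\gamma n\| \leq \frac{C_{b}}{(\log N)^2}.$$
   Context: For $x \in \mathbb{R}$, $\|x\|$ denotes the distance from $x$ to the nearest integer. For an integer $b \ge 2$, $$\mathfrak{D}_{b} := \left\{\sum_{d=0}^{\infty}a_{d}b^{d}: a_{d}\in \{0,1\},\ 0<\sum_{d=0}^{\infty}a_{d}<\infty\right\},$$ i.e. the set of positive integers whose base-$b$ digits all lie in $\{0,1\}$. ''Effective'' means that the constant can in principle be computed explicitly from $b$. $\log$ is the natural logarithm. *)

(* Defs.v *)
From mathcomp Require Import all_boot all_order all_algebra.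
From mathcomp Require Import all_classical all_reals all_analysis.

Set Implicit Arguments.
Unset Strict Implicit.
Unset Printing Implicit Defensive.

Import Order.TTheory GRing.Theory Num.Theory.

Local Open Scope classical_set_scope.
Local Open Scope ring_scope.

(* The finiteness of the digit sum of a 0/1 sequence amounts to the sequence
   vanishing from some rank k on; both series are then sums over d < k. *)
Definition binary_digits (b : nat) : set nat :=
  [set n | exists (a : nat -> nat) (k : nat),
    [/\ forall d, a d = 0%N \/ a d = 1%N,
        forall d, (k <= d)%N -> a d = 0%N,
        (0 < \sum_(0 <= d < k) a d)%N
      & n = (\sum_(0 <= d < k) a d * b ^ d)%N]].

Definition dist_int (R : realType) (x : R) : R :=
  inf [set `|x - m%:~R| | m in [set: int]].

Definition is_minimum (R : realType) (A : set R) (m : R) : Prop :=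
  A m /\ lbound A m.

(* Kleene's general recursive functions: the least class of total functions
   nat^k -> nat containing zero, successor and the projections, and closed under
   composition, primitive recursion and minimization of functions that have a
   zero for every value of the parameters.  The last two operations are given
   by the equations that determine h from f and g, resp. from f. *)
Inductive total_recursive : forall k : nat, (k.-tuple nat -> nat) -> Prop :=
| total_recursive_zero :
    total_recursive (fun _ : 0.-tuple nat => 0%N)
| total_recursive_succ :
    total_recursive (fun v : 1.-tuple nat => (thead v).+1)
| total_recursive_proj (k : nat) (i : 'I_k) :
    total_recursive (fun v : k.-tuple nat => tnth v i)
| total_recursive_comp (k m : nat) (f : m.-tuple nat -> nat)
    (g : 'I_m -> k.-tuple nat -> nat) :
    total_recursive f -> (forall i, total_recursive (g i)) ->
    total_recursive (fun v : k.-tuple nat => f [tuple g i v | i < m])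
| total_recursive_prim (k : nat) (f : k.-tuple nat -> nat)
    (g : k.+2.-tuple nat -> nat) (h : k.+1.-tuple nat -> nat) :
    total_recursive f -> total_recursive g ->
    (forall v : k.-tuple nat, h [tuple of 0%N :: v] = f v) ->
    (forall (n : nat) (v : k.-tuple nat),
       h [tuple of n.+1 :: v] =
       g [tuple of n :: h [tuple of n :: v] :: v]) ->
    total_recursive h
| total_recursive_min (k : nat) (f : k.+1.-tuple nat -> nat)
    (h : k.-tuple nat -> nat) :
    total_recursive f ->
    (forall v : k.-tuple nat, f [tuple of h v :: v] = 0%N) ->
    (forall (v : k.-tuple nat) (n : nat),
       (n < h v)%N -> f [tuple of n :: v] <> 0%N) ->
    total_recursive h.

(* C b is a computable real number, uniformly in b: given b and k, one can
   compute an integer p - q such that (p - q) / (k + 1) is within 1 / (k + 1)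
   of C b.  For a single b this is no constraint on an upper bound, since it can
   be replaced by a larger integer; the content is the uniformity. *)
Definition effective (R : realType) (C : nat -> R) : Prop :=
  exists p q : 2.-tuple nat -> nat,
    [/\ total_recursive p, total_recursive q &
        forall b k : nat,
          `|C b - ((p [tuple b; k])%:R - (q [tuple b; k])%:R) / k.+1%:R|
          <= k.+1%:R^-1].

(* Main.v *)
Require Import Defs.
From mathcomp Require Import all_boot all_order all_algebra.
From mathcomp Require Import all_classical all_reals all_analysis.
From mathcomp Require Import zify ring lra.

Set Implicit Arguments.
Unset Strict Implicit.
Unset Printing Implicit Defensive.

Import Order.TTheory GRing.Theory Num.Theory.
Import numFieldNormedType.Exports.

Local Open Scope classical_set_scope.
Local Open Scope ring_scope.

(** Write [||x||] for the distance from [x] to the integers. The numbers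
    [n = b ^ K + sum of some of the b ^ d, d < K] have digits 0 and 1 only, and
    a trigonometric sum over them is a product:
    [sum_n cos (2 pi j n gamma)] has absolute value at
    most [2 ^ K * prod_(d < K) |cos (pi j b ^ d gamma)|]
    ([sum_digit_sums_cos]). If these products are small for all frequencies
    [0 < j <= 8 ^ a], the points [n gamma] cannot all stay further than [2 ^- a]
    from the integers ([exists_close_to_int]). Multiplication by [b] makes the
    products small: it expands the distance to the integers until that distance
    exceeds [1 / (2 b)], so each time [||j b ^ d gamma|| >= b ^- L], one of the
    next [L] factors is at most [1 - 1 / (2 b ^ 2)] ([prod_norm_cos_le]).

    The method fails only if some [j b ^ d gamma] is within [b ^- L] of an
    integer, that is, if [b ^ d gamma] is extremely close to a fraction with
    denominator [j]. It is then enough to find a multiple [n] of [j] with few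
    digits, all 0 or 1: [n b ^ d gamma] is within [n b ^- L] of an integer.
    The same method, applied to the number [1 / j], provides [n] ([dvd_digits]):
    for [j] prime to [b] no exceptional case arises, since the [i b ^ d / j] that
    are not integers are at distance at least [1 / j] from the integers; the
    common factors of [j] and [b] are absorbed by a power of [b].

    Altogether [O(b ^ 6 a ^ 3)] digits suffice for the precision [2 ^- a]
    ([exists_digits_small]). For numbers up to [N] this allows [a] of the order of
    [(log N) ^ (1 / 3)], and [2 ^- a] is then much smaller than
    [1 / (log N) ^ 2]; all constants are explicit. *)

(** * Distance to the nearest integer *)

Lemma dist_int_le (R : realType) (x : R) (m : int) : dist_int x <= `|x - m%:~R|.
Proof.
apply: ge_inf; last by exists m.
by exists 0 => _ [k _ <-]; exact: normr_ge0.
Qed.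

Lemma dist_int_half (R : realType) (x : R) (m : int) :
  `|x - m%:~R| <= 2^-1 -> dist_int x = `|x - m%:~R|.
Proof.
move=> h; apply/eqP; rewrite eq_le dist_int_le /=.
apply: lb_le_inf; first by exists `|x - m%:~R|, m.
move=> _ [k _ <-].
have [->//|nkm] := eqVneq k m.
have : (1 : R) <= `|(k - m)%:~R|.
  by rewrite -intr_norm -[1]/(1%:~R) ler_int; lia.
have := ler_distD x k%:~R m%:~R; rewrite -intrB [`|k%:~R - x|]distrC.
by move: h; lra.
Qed.

Lemma dist_int_attained (R : realType) (x : R) :
  exists2 m : int, dist_int x = `|x - m%:~R| & `|x - m%:~R| <= 2^-1.
Proof.
have h : `|x - (Num.floor (x + 2^-1))%:~R| <= 2^-1.
  have /andP[] := floor_itv (x + 2^-1); rewrite intrD => h1 h2.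
  by rewrite ler_norml; apply/andP; split; lra.
by exists (Num.floor (x + 2^-1)) => //; exact: dist_int_half.
Qed.

Lemma dist_int_ge0 (R : realType) (x : R) : 0 <= dist_int x.
Proof. by have [m -> _] := dist_int_attained x. Qed.

Lemma dist_int_le_half (R : realType) (x : R) : dist_int x <= 2^-1.
Proof. by have [m ->] := dist_int_attained x. Qed.

Lemma dist_int_natM_le (R : realType) (c : nat) (x : R) :
  dist_int (c%:R * x) <= c%:R * dist_int x.
Proof.
have [m -> _] := dist_int_attained x.
apply: le_trans (dist_int_le _ (c%:Z * m)) _.
by rewrite intrM -mulrBr normrM normr_nat.
Qed.

Lemma dist_int_natM (R : realType) (c : nat) (x : R) :
  c%:R * dist_int x <= 2^-1 -> dist_int (c%:R * x) = c%:R * dist_int x.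
Proof.
have [m -> _] := dist_int_attained x => h.
have e : `|c%:R * x - (c%:Z * m)%:~R| = c%:R * `|x - m%:~R|.
  by rewrite intrM -mulrBr normrM normr_nat.
by rewrite -e; apply: dist_int_half; rewrite e.
Qed.

Lemma dist_int_frac (R : realType) (h n : nat) :
  dist_int (n%:R / h%:R : R) < h%:R^-1 -> (h %| n)%N.
Proof.
case: h => [|h]; first by rewrite invr0 ltNge dist_int_ge0.
have [m -> _] := dist_int_attained (n%:R / h.+1%:R : R).
have h0 : (0 : R) < h.+1%:R by rewrite ltr0n.
rewrite -(ltr_pM2r h0) mulVf ?gt_eqF// -[X in _ * X](ger0_norm (ltW h0)) -normrM.
rewrite mulrBl divfK ?gt_eqF// -[h.+1%:R]/(h.+1%:Z%:~R) -intrM.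
rewrite -[n%:R]/(n%:Z%:~R) -intrB -intr_norm -[1]/(1%:~R) ltr_int => hn.
have : n%:Z = m * h.+1%:Z by lia.
move=> /(congr1 absz); rewrite abszM absz_nat => ->.
by rewrite absz_nat dvdn_mull.
Qed.

(** * Cosines *)

Lemma cos_int (R : realType) (u : R) (k : int) :
  cos (u + pi *+ 2 * k%:~R) = cos u.
Proof.
case: k => n.
  by rewrite -[(Posz n)%:~R]/(n%:R) mulr_natr (periodicn (@cosD2pi R)).
rewrite NegzE mulrNz mulrN -[LHS](periodicn (@cosD2pi R) n.+1).
by rewrite mulr_natr subrK.
Qed.

(** Concavity of the sine gives Jordan's inequality: the mean slope of the sine
    over [[0, x]] is a value of the cosine to the left of [x], the mean slope
    over [[x, pi / 2]] one to the right of [x]. *)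
Lemma sin_jordan (R : realType) (x : R) : 0 <= x <= pi / 2 -> x <= pi / 2 * sin x.
Proof.
move=> /andP[x0 xp].
have MVTs (a b : R) : a <= b -> exists2 c, c \in `[a, b] & sin b - sin a = cos c * (b - a).
  move=> ab; apply: (@MVT_segment R sin cos) => //.
  exact/continuous_subspaceT/continuous_sin.
have [c cI e1] := MVTs _ _ x0.
have [d dI e2] := MVTs _ _ xp.
move: cI dI; rewrite !in_itv /= => /andP[c0 cx] /andP[xd dp].
rewrite sin0 !subr0 sin_pihalf in e1 e2.
have pp := @pi_ge0 R.
have cd : cos d <= cos c.
  have [->//|cd] := eqVneq d c.
  apply/ltW; rewrite ltr_cos ?in_itv /= ?lt_def ?cd; try lra.
have : x * (1 - sin x) <= sin x * (pi / 2 - x).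
  rewrite e2 e1 mulrCA -mulrA ler_wpM2r// mulr_ge0//; lra.
lra.
Qed.

(** With [r] the distance from [y] to the nearest integer, [`|cos (pi y)| = cos (pi r)]
    and [sin (pi r) >= 2 r]. *)
Lemma norm_cos_le (R : realType) (y : R) :
  `|cos (pi * y)| <= 1 - 2 * dist_int y ^+ 2.
Proof.
have [m e h] := dist_int_attained y.
set r := dist_int y in e *.
have [r0 rh] : 0 <= r /\ r <= 2^-1 by rewrite e; split=> //; exact: normr_ge0.
have ec : cos (pi * y) ^+ 2 = cos (pi * r) ^+ 2.
  have : cos (pi * y *+ 2) = cos (pi * r *+ 2).
    have -> : pi * y *+ 2 = pi * (y - m%:~R) *+ 2 + pi *+ 2 * m%:~R by ring.
    rewrite cos_int e -[RHS]cos_norm -[LHS]cos_norm; congr cos.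
    by rewrite !normrMn !normrM normr_id.
  by rewrite !cos_mulr2n => h2; lra.
have pp := pi_ge2 R.
have := @sin_jordan R (pi * r).
have -> : 0 <= pi * r <= pi / 2 by apply/andP; split; nra.
move=> /(_ isT) hj.
have hs : 2 * r <= sin (pi * r) by nra.
have hc : `|cos (pi * y)| ^+ 2 <= 1 - 4 * r ^+ 2.
  rewrite real_normK ?num_real// ec cos2sin2; nra.
have c0 := normr_ge0 (cos (pi * y)).
rewrite leNgt; apply/negP => hlt; nra.
Qed.

Lemma sum_bin_pascal (R : pzRingType) (n : nat) (g : nat -> R) :
  \sum_(t < n.+2) 'C(n.+1, t)%:R * g t =
  \sum_(t < n.+1) 'C(n, t)%:R * (g t + g t.+1).
Proof.
under [RHS]eq_bigr do rewrite mulrDr.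
rewrite big_split /= big_ord_recl /= bin0.
under eq_bigr do rewrite /bump leq0n add1n binS natrD mulrDl.
rewrite big_split /= addrA; congr (_ + _).
rewrite [RHS]big_ord_recl bin0 /=; congr (_ + _).
by rewrite big_ord_recr /= bin_small// mul0r addr0.
Qed.

Lemma sum_bin_cos (R : realType) (n : nat) (u v : R) :
  \sum_(t < n.+1) 'C(n, t)%:R * cos (u + 2 * t%:R * v) =
  2 ^+ n * cos (u + n%:R * v) * cos v ^+ n.
Proof.
elim: n u => [|n ih] u.
  by rewrite big_ord1 bin0 !expr0 mulr0 !mul0r addr0; ring.
rewrite (sum_bin_pascal n (fun t => cos (u + 2 * t%:R * v))).
have e (t : nat) : cos (u + 2 * t%:R * v) + cos (u + 2 * t.+1%:R * v) =
    2 * cos v * cos (u + v + 2 * t%:R * v).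
  set z := u + v + 2 * t%:R * v.
  have -> : u + 2 * t%:R * v = z - v by rewrite /z; ring.
  have -> : u + 2 * t.+1%:R * v = z + v.
    by rewrite /z -[t.+1]addn1 natrD; ring.
  by rewrite cosB cosD; ring.
under eq_bigr do rewrite e mulrCA.
rewrite -mulr_sumr ih !exprS -[n.+1]addn1 natrD.
by rewrite (_ : u + v + n%:R * v = u + (n%:R + 1) * v); ring.
Qed.

Lemma central_bin_ge (m : nat) : (0 < m)%N -> (4 ^ m <= 2 * m * 'C(2 * m, m))%N.
Proof.
elim: m => // -[|m] ih _ //.
have {}ih := ih isT.
set k := m.+1 in ih *.
have e1 := mul_bin_diag (2 * k).+2 k.
have e2 := mul_bin_down (2 * k).+1 k.
rewrite /= in e1 e2.
rewrite (_ : 2 * k.+1 = (2 * k).+2)%N; last by lia.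
rewrite (_ : (2 * k).+1 - k = k.+1)%N in e2; last by lia.
rewrite expnS; nia.
Qed.

Lemma pow_one_sub_le (R : realType) (x : R) (n r : nat) :
  0 <= x <= 1 -> 1 <= n%:R * x -> (1 - x) ^+ (n * r) <= 2^-1 ^+ r.
Proof.
move=> /andP[x0 x1] hn; rewrite exprM.
have y0 : 0 <= 1 - x by lra.
apply: lerXn2r; rewrite ?nnegrE ?exprn_ge0//.
have h : (1 - x) ^+ n * (1 + x) ^+ n <= 1.
  rewrite -exprMn; apply: exprn_ile1; nra.
have bern : forall k : nat, 1 + k%:R * x <= (1 + x) ^+ k.
  elim=> [|k ih]; first by rewrite mul0r addr0.
  rewrite exprS -[k.+1]addn1 natrD.
  have kx0 : 0 <= k%:R * x by exact: mulr_ge0.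
  nra.
have := bern n; have := exprn_ge0 n y0; nra.
Qed.

(** If no point of [s] were within [2^-a] of an integer, the nonnegative
    trigonometric polynomial [cos (pi y) ^+ (2 * m)], [m = 8 ^ a], would be tiny
    at all of them. But its frequencies are the [t - m] with binomial weights,
    the frequency [0] has weight ['C(2 m, m) >= 4 ^ m / (2 m)], and by
    hypothesis the other frequencies cannot cancel that contribution. *)
Lemma exists_close_to_int (R : realType) (s : seq R) (a : nat) :
  s != [::] ->
  (forall j : nat, (0 < j <= 8 ^ a)%N ->
     - (size s)%:R * 2^-1 ^+ (3 * a + 2) <=
     \sum_(y <- s) cos (pi *+ 2 * j%:R * y)) ->
  exists2 y, y \in s & dist_int y <= 2^-1 ^+ a.
Proof.
case: a => [|a'].
  case: s => // y s _ _; exists y; first exact: mem_head.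
  by rewrite expr0; have := dist_int_le_half y; lra.
set a := a'.+1; move=> s0 hs; apply: contrapT => hno.
have far y : y \in s -> 2^-1 ^+ a < dist_int y.
  by move=> ys; rewrite ltNge; apply/negP => ?; apply: hno; exists y.
set m := (8 ^ a)%N in hs.
set rho : R := 2^-1 ^+ (3 * a + 2) in hs.
set w := fun t : nat => \sum_(y <- s) cos (pi *+ 2 * (`|t - m|%N)%:R * y).
have n0 : (0 : R) < (size s)%:R by rewrite ltr0n lt0n size_eq0.
have rho0 : 0 <= rho by exact: exprn_ge0.
have eq_kernel :
    \sum_(t < (2 * m).+1) 'C(2 * m, t)%:R * w t =
    4 ^+ m * \sum_(y <- s) cos (pi * y) ^+ (2 * m).
  under eq_bigr do rewrite mulr_sumr.
  rewrite exchange_big mulr_sumr /=; apply: eq_bigr => y _.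
  have := @sum_bin_cos R (2 * m) (- (pi *+ 2 * m%:R * y)) (pi * y).
  rewrite (_ : _ + (2 * m)%:R * _ = 0); last by rewrite natrM; ring.
  rewrite cos0 mulr1 exprM -natrX => <-.
  apply: eq_bigr => t _; congr (_ * _).
  rewrite -[RHS]cos_norm -[LHS]cos_norm; congr cos.
  rewrite !normrM (_ : _ + _ = pi *+ 2 * (t%:R - m%:R) * y); last by ring.
  rewrite !normrM; congr (_ * _ * _).
  rewrite normr_nat -[(`|t - m|%N)%:R]/((`|t - m|%N)%:Z%:~R) abszE intr_norm.
  by rewrite intrB.
have low (t : 'I_(2 * m).+1) :
    'C(2 * m, t)%:R * (- (size s)%:R * rho + (size s)%:R * (t == m :> nat)%:R)
    <= 'C(2 * m, t)%:R * w t.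
  apply: ler_wpM2l => //.
  have [e|ne] := eqVneq (t : nat) m.
    rewrite /w e subrr absz0 mulr1.
    under eq_bigr do rewrite mulr0 mul0r cos0.
    rewrite big_const_seq count_predT iter_addr_0; nra.
  rewrite mulr0 addr0; apply: hs; have := ltn_ord t; lia.
(* [8 ^ a] is so much larger than the square of [2 ^ a] that the power [2 * m]
   turns the deficit of the cosine into a factor [2 ^- (2 ^ (a + 2))]. *)
have up y : y \in s -> cos (pi * y) ^+ (2 * m) <= 2^-1 ^+ (3 * a + 3).
  move=> /far fy.
  set x : R := 2 * 2^-1 ^+ (2 * a).
  have x0 : 0 <= x by rewrite mulr_ge0// exprn_ge0.
  have x1 : x <= 1.
    by rewrite /x /a mulnS exprD expr2; have := @exprn_ile1 R (2 * a') 2^-1; lra.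
  have cx : `|cos (pi * y)| <= 1 - x.
    apply: le_trans (norm_cos_le y) _; rewrite /x mulnC exprM.
    have := exprn_ge0 a (_ : 0 <= 2^-1 :> R); rewrite invr_ge0 ler0n => /(_ isT).
    nra.
  have -> : (2 * m = 2 ^ (2 * a' + 1) * 2 ^ (a + 2))%N.
    by rewrite /m /a -[8%N]/(2 ^ 3)%N -expnM -expnS -expnD; congr (_ ^ _)%N; lia.
  apply: le_trans (_ : (1 - x) ^+ (2 ^ (2 * a' + 1) * 2 ^ (a + 2)) <= _).
    apply: le_trans (ler_norm _) _; rewrite normrX.
    by apply: lerXn2r; rewrite ?nnegrE//; lra.
  apply: le_trans (pow_one_sub_le _ _ _) _; first by rewrite x0.
    rewrite /x /a natrX (_ : 2 * a'.+1 = (2 * a' + 1).+1)%N; last by lia.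
    by rewrite exprS mulrA divff// mul1r -exprMn divff// expr1n.
  apply: ler_wiXn2l; [lra|lra|].
  have : (a' < 2 ^ a')%N by exact: ltn_expl.
  rewrite /a addSn addn2 !expnS; lia.
have sum_bin : \sum_(t < (2 * m).+1) 'C(2 * m, t)%:R = 4 ^+ m :> R.
  have := @sum_bin_cos R (2 * m) 0 0; rewrite !mulr0 addr0 cos0 expr1n !mulr1.
  rewrite exprM -natrX => <-; apply: eq_bigr => t _.
  by rewrite !mulr0 addr0 cos0 mulr1.
have lowE : \sum_(t < (2 * m).+1)
    'C(2 * m, t)%:R * (- (size s)%:R * rho + (size s)%:R * (t == m :> nat)%:R)
    = (size s)%:R * ('C(2 * m, m)%:R - rho * 4 ^+ m) :> R.
  under eq_bigr do rewrite mulrDr.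
  rewrite big_split /= -mulr_suml sum_bin.
  have lm : (m < (2 * m).+1)%N by lia.
  rewrite (bigD1 (Ordinal lm)) //= eqxx mulr1 big1 ?addr0; first by ring.
  move=> i; rewrite -val_eqE /= => /negbTE ->; by rewrite !mulr0.
have sumlow : (size s)%:R * ('C(2 * m, m)%:R - rho * 4 ^+ m) <=
    4 ^+ m * \sum_(y <- s) cos (pi * y) ^+ (2 * m).
  by rewrite -lowE -eq_kernel; apply: ler_sum => t _; exact: low.
have upsum : \sum_(y <- s) cos (pi * y) ^+ (2 * m) <=
    (size s)%:R * 2^-1 ^+ (3 * a + 3).
  rewrite mulr_natl -[leRHS](iter_addr_0 (size s)) -(count_predT s) -big_const_seq.
  by rewrite big_seq [leRHS]big_seq; apply: ler_sum => y; exact: up.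
have m0 : (0 < m)%N by rewrite expn_gt0.
have := central_bin_ge m0; rewrite -(ler_nat R) !natrM natrX => hc.
have m8 : m%:R * 2^-1 ^+ (3 * a) = 1 :> R.
  by rewrite /m natrX exprM -exprMn (_ : 8 * _ = 1) ?expr1n// !exprS expr0; lra.
have p4 : (0 : R) < 4 ^+ m by exact: exprn_gt0.
move: sumlow upsum hc m8; rewrite /rho !exprD.
set e : R := 2^-1 ^+ (3 * a); set B : R := 'C(_, _)%:R; set P : R := 4 ^+ m.
set S := \sum_(y <- s) _; set n : R := (size s)%:R; set M : R := m%:R.
rewrite -/P in p4; rewrite -/n in n0.
move=> h1 h2 h3 h4.
have h5 : P * S <= P * (n * (e * 2^-1 ^+ 3)) by rewrite ler_pM2l.
have : n * (B - e * 2^-1 ^+ 2 * P) <= n * (P * e * 2^-1 ^+ 3) by lra.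
rewrite ler_pM2l// => h6.
have M0 : 0 <= M by [].
have : 2 * M * B <= 2 * M * (P * e * 2^-1 ^+ 3 + e * 2^-1 ^+ 2 * P).
  by apply: ler_wpM2l; lra.
rewrite (_ : 2 * M * (P * e * 2^-1 ^+ 3 + e * 2^-1 ^+ 2 * P) = (M * e) * (3 / 4) * P).
  by rewrite h4; lra.
by field.
Qed.

(** * Integers with digits 0 and 1 *)

Fixpoint digit_sums (b K : nat) : seq nat :=
  if K is K'.+1 then
    digit_sums b K' ++ [seq (b ^ K' + n)%N | n <- digit_sums b K']
  else [:: 0%N].

Lemma size_digit_sums (b K : nat) : size (digit_sums b K) = (2 ^ K)%N.
Proof. by elim: K => //= K ih; rewrite size_cat size_map ih expnS; lia. Qed.

Lemma digit_sumsP (b K n : nat) : n \in digit_sums b K ->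
  exists a : nat -> nat, [/\ forall d, a d = 0%N \/ a d = 1%N,
    forall d, (K <= d)%N -> a d = 0%N
    & n = (\sum_(0 <= d < K) a d * b ^ d)%N].
Proof.
elim: K n => [|K ih] n /=.
  rewrite inE => /eqP ->; exists (fun=> 0%N); split=> //; first by left.
  by rewrite big_nil.
rewrite mem_cat => /orP[/ih[a [a01 a0 ->]]|/mapP[n' /ih[a [a01 a0 ->]] ->]].
  exists a; split=> // [d /ltnW|]; first exact: a0.
  by rewrite big_nat_recr//= a0// mul0n addn0.
exists (fun d => if d == K then 1%N else a d); split=> [d|d Kd|].
- by case: eqP; [right|].
- by rewrite gtn_eqF// a0// ltnW.
rewrite big_nat_recr//= eqxx mul1n addnC; congr (_ + _)%N.
by apply: eq_big_nat => d /andP[_ dK]; rewrite ltn_eqF.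
Qed.

Lemma digit_sums_lt (b K n : nat) : (2 <= b)%N ->
  n \in digit_sums b K -> (n < b ^ K)%N.
Proof.
move=> b2; elim: K n => [|K ih] n /=; first by rewrite inE => /eqP ->.
have bK : (2 * b ^ K <= b ^ K.+1)%N by rewrite expnS leq_mul2r b2 orbT.
rewrite mem_cat => /orP[/ih|/mapP[n' /ih + ->]]; lia.
Qed.

(** The extra leading digit 1 excludes the empty sum. *)
Lemma binary_digits_lead (b K n : nat) : n \in digit_sums b K ->
  binary_digits b (b ^ K + n)%N.
Proof.
move=> h; have : (b ^ K + n)%N \in digit_sums b K.+1.
  by rewrite /= mem_cat map_f ?orbT.
move: h => /digit_sumsP[a [a01 a0 ->]] _.
exists (fun d => if d == K then 1%N else a d), K.+1; split=> [d|d Kd||].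
- by case: eqP; [right|].
- by rewrite gtn_eqF// a0// ltnW.
- by rewrite big_nat_recr//= eqxx addn1.
rewrite big_nat_recr//= eqxx mul1n addnC; congr (_ + _)%N.
by apply: eq_big_nat => d /andP[_ dK]; rewrite ltn_eqF.
Qed.

Lemma binary_digits_shift (b e n : nat) :
  binary_digits b n -> binary_digits b (b ^ e * n)%N.
Proof.
elim: e => [|e ih] /= h; first by rewrite expn0 mul1n.
have {ih}[a [k [a01 a0 ak en]]] := ih h.
rewrite expnS -mulnA en; exists (fun d => if d is d'.+1 then a d' else 0%N), k.+1.
split=> [[|d]|[|d]|| ] //; first by left.
- by move=> kd; exact: a0.
- by rewrite big_nat_recl.
rewrite big_nat_recl//= add0n big_distrr /=; apply: eq_bigr => d _.
by rewrite mulnCA expnS.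
Qed.

Lemma binary_digits_gt0 (b n : nat) : (0 < b)%N -> binary_digits b n -> (0 < n)%N.
Proof.
move=> b0 [a [k [_ _ + ->]]]; rewrite !lt0n; apply: contra_neq => h.
apply: big1_seq => d /andP[_ dk].
move/eqP: h; rewrite sum_nat_seq_eq0 => /allP/(_ d dk) /=.
by rewrite muln_eq0 expn_eq0 -[b == _]negbK -lt0n b0 /= orbF => /eqP.
Qed.

(** The two choices of the digit [d] give cosines whose arguments differ by
    [2 * b ^ d * v]; adding them factors out [2 * cos (b ^ d * v)]. *)
Lemma sum_digit_sums_cos (R : realType) (b K : nat) (u v : R) :
  \sum_(n <- digit_sums b K) cos (u + 2 * n%:R * v) =
  2 ^+ K * cos (u + \sum_(d < K) (b ^ d)%:R * v) * \prod_(d < K) cos ((b ^ d)%:R * v).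
Proof.
elim: K u => [|K ih] u /=.
  by rewrite big_seq1 !big_ord0 mulr0 mul0r !addr0 expr0; ring.
rewrite big_cat big_map /= ih.
have -> : \sum_(n <- digit_sums b K) cos (u + 2 * (b ^ K + n)%:R * v) =
          \sum_(n <- digit_sums b K) cos (u + 2 * (b ^ K)%:R * v + 2 * n%:R * v).
  by apply: eq_bigr => n _; congr cos; rewrite natrD; ring.
rewrite ih !big_ord_recr /= exprS.
set c : R := (b ^ K)%:R * v; set S := \sum_(d < K) _; set P := \prod_(d < K) _.
rewrite (_ : u + S = u + S + c - c); last by ring.
rewrite (_ : u + 2 * (b ^ K)%:R * v + S = u + S + c + c); last by rewrite /c; ring.
rewrite (_ : u + (S + c) = u + S + c); last by ring.
set z := u + S + c.
by rewrite cosB cosD; ring.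
Qed.

(** * Multiplication by the base *)

Lemma dist_int_powM (R : realType) (b L : nat) (y : R) : (2 <= b)%N ->
  (forall d, (d < L)%N -> dist_int ((b ^ d)%:R * y) < (2 * b%:R)^-1) ->
  dist_int ((b ^ L)%:R * y) = (b ^ L)%:R * dist_int y.
Proof.
move=> b2; elim: L => [|L ih] h; first by rewrite expn0 !mul1r.
have b0 : (0 : R) < b%:R by rewrite ltr0n; lia.
rewrite expnS natrM -[LHS]/(dist_int _) -mulrA dist_int_natM.
  by rewrite ih ?mulrA// => d dL; apply: h; exact: ltnW.
have := h L (ltnSn L); rewrite invfM => /ltW.
by rewrite -(ler_pM2l b0) mulrCA divff ?mulr1// gt_eqF.
Qed.

(** As long as [b ^ d * y] stays close to the integers, its distance to them is
    multiplied by [b] at each step; it cannot do so for [L] steps. *)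
Lemma dist_int_pow_escape (R : realType) (b L : nat) (y : R) : (2 <= b)%N ->
  (b ^ L)%:R^-1 <= dist_int y ->
  exists2 d, (d < L)%N & (2 * b%:R)^-1 <= dist_int ((b ^ d)%:R * y).
Proof.
move=> b2 hy; apply: contrapT => hno.
have /(dist_int_powM b2) e d : (d < L)%N -> dist_int ((b ^ d)%:R * y) < (2 * b%:R)^-1.
  by move=> dL; rewrite ltNge; apply/negP => ?; apply: hno; exists d.
have bL : (0 : R) < (b ^ L)%:R by rewrite ltr0n expn_gt0; lia.
have := dist_int_le_half ((b ^ L)%:R * y); rewrite e.
by move: hy; rewrite -(ler_pM2l bL) divff ?gt_eqF//; lra.
Qed.

Lemma prod_norm_cos_le (R : realType) (b L r : nat) (y : R) :
  (2 <= b)%N -> (0 < L)%N ->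
  (forall d, (d < L * (2 * b ^ 2 * r))%N ->
     (b ^ L)%:R^-1 <= dist_int ((b ^ d)%:R * y)) ->
  \prod_(d < L * (2 * b ^ 2 * r)) `|cos ((b ^ d)%:R * (pi * y))| <= 2^-1 ^+ r.
Proof.
move=> b2 L0 hy.
have b0 : (2 : R) <= b%:R by rewrite ler_nat.
set x : R := (2 * b ^ 2)%:R^-1.
have xE : (2 * b ^ 2)%:R * x = 1 by rewrite divff// pnatr_eq0; nia.
have x0 : 0 <= x by rewrite invr_ge0.
have x1 : x <= 1 by rewrite -xE ler_peMl// ler1n; nia.
apply: le_trans (_ : (1 - x) ^+ (2 * b ^ 2 * r) <= _); last first.
  by apply: pow_one_sub_le; rewrite ?x0 ?xE.
elim: (2 * b ^ 2 * r)%N hy => [|s ih] hy.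
  by rewrite muln0 big_ord0.
rewrite mulnSr big_split_ord exprSr /=.
apply: ler_pM; rewrite ?prodr_ge0//.
  by apply: ih => d hd; apply: hy; lia.
have [||d dL hd] := @dist_int_pow_escape R b L ((b ^ (L * s))%:R * y) => //.
  by apply: hy; lia.
rewrite (bigD1 (Ordinal dL)) //=.
rewrite -[leRHS]mulr1; apply: ler_pM => //; first exact: prodr_ge0.
  rewrite mulrCA; apply: le_trans (norm_cos_le _) _.
  rewrite expnD natrM -mulrA (mulrCA (b ^ (L * s))%:R).
  have xb : x = 2 * (2 * b%:R)^-1 ^+ 2.
    by rewrite /x natrM natrX; field; lra.
  by rewrite xb lerD2l lerN2 ler_pM2l// ler_sqr ?nnegrE ?dist_int_ge0.
by apply: prodr_ile1 => i _; rewrite normr_ge0 cos_max.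
Qed.

(** * Small fractional parts *)

(** In the first alternative the cosines at frequency [j] all equal 1, which can
    only help; in the second one their sum is small by [prod_norm_cos_le]. *)
Lemma exists_digits_close (R : realType) (b L a : nat) (y : R) :
  (2 <= b)%N -> (0 < L)%N ->
  (forall j : nat, (0 < j <= 8 ^ a)%N ->
     (exists k : int, j%:R * y = k%:~R) \/
     (forall d, (d < L * (2 * b ^ 2 * (3 * a + 2)))%N ->
        (b ^ L)%:R^-1 <= dist_int ((b ^ d)%:R * (j%:R * y)))) ->
  exists n : nat, [/\ binary_digits b n,
    (n < b ^ (L * (2 * b ^ 2 * (3 * a + 2))).+1)%N
    & dist_int (n%:R * y) <= 2^-1 ^+ a].
Proof.
move=> b2 L0 hj; set K := (L * _)%N in hj *.
set s := [seq (b ^ K + n)%:R * y | n <- digit_sums b K].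
have ss : (size s)%:R = 2 ^+ K :> R by rewrite size_map size_digit_sums natrX.
have [||_ /mapP[n nK ->] hn] := @exists_close_to_int R s a.
- by rewrite -size_eq0 size_map size_digit_sums expn_eq0.
- move=> j jI; rewrite ss big_map.
  have [[k ek]|far] := hj j jI.
    under eq_bigr => n _.
      rewrite (_ : _ * _ = 0 + pi *+ 2 * ((b ^ K + n)%:Z * k)%:~R).
        by rewrite cos_int cos0 over.
      by rewrite intrM -ek; ring.
    rewrite big_const_seq count_predT iter_addr_0 size_digit_sums natrX.
    apply: le_trans (_ : 0 <= _); last exact: exprn_ge0.
    by rewrite mulNr oppr_le0 mulr_ge0 ?exprn_ge0.
  rewrite (_ : \sum_(n <- _) _ = \sum_(n <- digit_sums b K)
      cos (pi *+ 2 * j%:R * ((b ^ K)%:R * y) + 2 * n%:R * (pi * (j%:R * y)))).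
    rewrite sum_digit_sums_cos mulNr -mulrN -mulrA ler_pM2l ?exprn_gt0//.
    set u := cos _; have := prod_norm_cos_le b2 L0 far.
    rewrite -normr_prod; set P := \prod_(d < _) _ => hP.
    have : `|u * P| <= 2^-1 ^+ (3 * a + 2).
      by rewrite normrM -[leRHS]mul1r ler_pM// cos_max.
    by rewrite ler_norml => /andP[].
  by apply: eq_bigr => n _; congr cos; rewrite natrD; ring.
exists (b ^ K + n)%N; split=> //; first exact: binary_digits_lead.
have := digit_sums_lt b2 nK; have : (2 * b ^ K <= b ^ K.+1)%N.
  by rewrite expnS leq_mul2r b2 orbT.
lia.
Qed.

Lemma coprime_factor (b h : nat) : (2 <= b)%N -> (0 < h)%N ->
  exists e g : nat, [/\ (h %| b ^ e * g)%N, coprime g b, (0 < g)%N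
    & (2 ^ e * g <= h)%N].
Proof.
move=> b2; have [N] := ubnP h; elim: N h => // N ih h hN h0.
have [cop|ncop] := boolP (coprime h b).
  by exists 0%N, h; split=> //; rewrite expn0 mul1n.
set g := gcdn h b in ncop.
have g0 : (0 < g)%N by rewrite gcdn_gt0 h0.
have g2 : (2 <= g)%N by rewrite ltn_neqAle g0 andbT eq_sym.
have /dvdnP[h' eh] : (g %| h)%N by exact: dvdn_gcdl.
have h'0 : (0 < h')%N by move: h0; rewrite eh muln_gt0 => /andP[].
have [|//|e [c [dv cop c0 le]]] := ih h'; first by move: hN; rewrite eh; nia.
exists e.+1, c; split=> //.
  by rewrite eh expnS -mulnA mulnC; apply: dvdn_mul; rewrite ?dvdn_gcdr// mulnC.
rewrite expnS eh; nia.
Qed.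

(** For [y = 1 / h], precision [2 ^- (3 a + 1) < 1 / h] means divisibility by
    [h]. If [h] does not divide [j], it does not divide any [b ^ d * j], so that
    [b ^ d * j / h] stays at distance at least [1 / h] from the integers. The
    parameter [R] is the field in which the cosines of the proof are taken. *)
Lemma coprime_dvd_digits (R : realType) (b a h : nat) :
  (2 <= b)%N -> (0 < h <= 8 ^ a)%N -> coprime h b ->
  exists n : nat, [/\ binary_digits b n,
    (n < b ^ ((3 * a + 1) * (2 * b ^ 2 * (3 * (3 * a + 1) + 2))).+1)%N
    & (h %| n)%N].
Proof.
move=> b2 /andP[h0 ha] cop.
have hr : (0 : R) < h%:R by rewrite ltr0n.
have hlt : (h < b ^ (3 * a + 1))%N.
  apply: leq_ltn_trans ha _; rewrite -[8%N]/(2 ^ 3)%N -expnM addn1.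
  apply: leq_trans (_ : 2 ^ (3 * a).+1 <= _)%N; first by rewrite ltn_exp2l.
  by rewrite leq_exp2r.
have h2lt : (h < 2 ^ (3 * a + 1))%N.
  apply: leq_ltn_trans ha _; rewrite -[8%N]/(2 ^ 3)%N -expnM addn1.
  by rewrite ltn_exp2l.
have [||n [nb nlt nd]] :=
    @exists_digits_close R b (3 * a + 1) (3 * a + 1) h%:R^-1 b2.
- by rewrite addn1.
- move=> j _; have [/dvdnP[k ->]|ndv] := boolP (h %| j)%N; [left|right].
    by exists k%:Z; rewrite natrM mulfK ?gt_eqF.
  move=> d _; rewrite leNgt; apply/negP => small; move/negP: ndv; apply.
  have : (h %| b ^ d * j)%N.
    apply: (@dist_int_frac R); rewrite natrM -mulrA.
    apply: lt_trans small _; rewrite ltf_pV2 ?posrE ?ltr_nat//.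
    by rewrite ltr0n expn_gt0; lia.
  by rewrite Gauss_dvdr// coprimeXr.
exists n; split=> //; apply: (@dist_int_frac R).
apply: le_lt_trans nd _; rewrite exprVn -natrX.
by rewrite ltf_pV2 ?posrE ?ltr_nat// ltr0n expn_gt0.
Qed.

(** The part of [h] made of primes dividing [b] divides a power of [b], and
    multiplication by that power only shifts the digits. *)
Lemma dvd_digits (R : realType) (b a h : nat) :
  (2 <= b)%N -> (0 < h <= 8 ^ a)%N ->
  exists n : nat, [/\ binary_digits b n,
    (n < b ^ (3 * a + ((3 * a + 1) * (2 * b ^ 2 * (3 * (3 * a + 1) + 2))).+1))%N
    & (h %| n)%N].
Proof.
move=> b2 /andP[h0 ha].
have [e [g [dv cop g0 le]]] := coprime_factor b2 h0.
have ea : (e <= 3 * a)%N.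
  rewrite -(@leq_exp2l 2)// expnM; apply: leq_trans ha.
  by apply: leq_trans le; rewrite leq_pmulr.
have [|n [nb nlt gn]] := @coprime_dvd_digits R b a g b2 _ cop.
  rewrite g0 (leq_trans _ ha)// (leq_trans _ le)// leq_pmull// expn_gt0//.
exists (b ^ e * n)%N; split; first exact: binary_digits_shift.
  rewrite expnD; apply: leq_ltn_trans (_ : b ^ (3 * a) * n < _)%N.
    by rewrite leq_mul2r leq_exp2l// ea orbT.
  by rewrite ltn_pmul2l// expn_gt0; lia.
by apply: dvdn_trans dv _; rewrite dvdn_mul.
Qed.

(** Either all [j * gamma], [j <= 8 ^ a], escape from the integers often enough
    under multiplication by [b], or some [b ^ d * j * gamma] is extremely close to
    an integer; then so is its product with [n / j], for [n] a multiple of [j]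
    with few digits, all of them [0] or [1]. *)
Lemma exists_digits_small (R : realType) (b a : nat) (gamma : R) :
  (2 <= b)%N ->
  exists n : nat, [/\ binary_digits b n, (n <= b ^ ((12 * b ^ 2 * a) ^ 3))%N
    & dist_int (gamma * n%:R) <= 2^-1 ^+ a].
Proof.
move=> b2; have [->|a0] := posnP a.
  exists 1%N; split; last by have := dist_int_le_half (gamma * 1%:R); lra.
    exact: (@binary_digits_lead b 0 0).
  by rewrite muln0.
(* [K2 + 1 + 3 * a] digits suffice for a multiple of any [j <= 8 ^ a]; [L] leaves
   room for such a multiplier and for the precision [b ^- a <= 2 ^- a]. *)
set K2 := ((3 * a + 1) * (2 * b ^ 2 * (3 * (3 * a + 1) + 2)))%N.
set L := (K2 + 1 + 4 * a)%N.
set K := (L * (2 * b ^ 2 * (3 * a + 2)))%N.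
have Kle : (K + L <= (12 * b ^ 2 * a) ^ 3)%N.
  set B := (b ^ 2)%N in K2 L K *; have B1 : (1 <= B)%N by rewrite expn_gt0; lia.
  have aB : (a <= a * B)%N by rewrite leq_pmulr.
  have aaB : (a * B <= a * (a * B))%N by rewrite leq_pmull.
  have K2le : (K2 <= 112 * (a * (a * B)))%N.
    by rewrite /K2; apply: leq_trans (_ : (4 * a) * (2 * B * (14 * a)) <= _)%N;
      [apply: leq_mul; [lia|rewrite leq_mul2l; lia]|lia].
  have Lle : (L <= 117 * (a * (a * B)))%N by rewrite /L; lia.
  have sle : (2 * B * (3 * a + 2) + 1 <= 11 * (a * B))%N.
    by apply: leq_trans (_ : 2 * B * (5 * a) + a * B <= _)%N;
      [apply: leq_add; [rewrite leq_mul2l; lia|lia]|lia].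
  have -> : (K + L = L * (2 * B * (3 * a + 2) + 1))%N by rewrite /K; lia.
  apply: leq_trans (leq_mul Lle sle) _.
  apply: leq_trans (_ : 1728 * (a * (a * B) * (a * B)) * B <= _)%N; last first.
    by rewrite !expnS expn0; lia.
  by apply: leq_trans (_ : 1728 * (a * (a * B) * (a * B)) <= _)%N;
    [lia|rewrite leq_pmulr].
have bP k : (0 < b ^ k)%N by rewrite expn_gt0; lia.
have [far|near] := pselect (forall j : nat, (0 < j <= 8 ^ a)%N ->
    forall d, (d < K)%N -> (b ^ L)%:R^-1 <= dist_int ((b ^ d)%:R * (j%:R * gamma))).
  have [||n [nb nlt nd]] := @exists_digits_close R b L a gamma b2.
  - by rewrite /L; lia.
  - by move=> j jI; right; exact: far.
  exists n; split=> //; last by rewrite mulrC.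
  by apply: leq_trans (ltnW nlt) _; rewrite leq_exp2l//; move: Kle; rewrite /L; lia.
have [j [d [jI dK small]]] : exists j d : nat, [/\ (0 < j <= 8 ^ a)%N, (d < K)%N
    & dist_int ((b ^ d)%:R * (j%:R * gamma)) < (b ^ L)%:R^-1].
  apply: contrapT => hno; apply: near => j jI d dK; rewrite leNgt; apply/negP => ?.
  by apply: hno; exists j, d.
have [n [nb nlt /dvdnP[c nE]]] := dvd_digits R b2 jI.
rewrite -/K2 in nlt.
exists (b ^ d * n)%N; split; first exact: binary_digits_shift.
  apply: leq_trans (_ : b ^ K * b ^ L <= _)%N.
    apply: leq_mul; first by rewrite leq_exp2l// ltnW.
    by apply: leq_trans (ltnW nlt) _; rewrite leq_exp2l// /L; lia.
  by rewrite -expnD leq_exp2l.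
rewrite (_ : gamma * _ = c%:R * ((b ^ d)%:R * (j%:R * gamma))); last first.
  by rewrite nE !natrM; ring.
apply: le_trans (dist_int_natM_le _ _) _.
apply: le_trans (_ : (b ^ (L - a))%:R * (b ^ L)%:R^-1 <= _).
  apply: ler_pM; rewrite ?dist_int_ge0//; last exact: ltW.
  rewrite ler_nat; apply: leq_trans (_ : n <= _)%N.
    by rewrite nE leq_pmulr//; case/andP: jI.
  by apply: leq_trans (ltnW nlt) _; rewrite leq_exp2l// /L; lia.
have LE : L = (L - a + a)%N by rewrite subnK// /L; lia.
rewrite {2}LE expnD natrM invfM mulrA divff ?mul1r; last by rewrite pnatr_eq0 -lt0n.
by rewrite exprVn -natrX lef_pV2 ?posrE ?ltr0n ?bP ?expn_gt0// ler_nat leq_exp2r.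
Qed.

(** * Computability of the constant *)

Lemma total_recursive_ext (k : nat) (f g : k.-tuple nat -> nat) :
  f =1 g -> total_recursive f -> total_recursive g.
Proof. by move=> /funext ->. Qed.

Lemma total_recursive_comp1 (k : nat) (f : k.-tuple nat -> nat) :
  total_recursive f -> total_recursive (fun v => (f v).+1).
Proof.
move=> hf; have := @total_recursive_comp k 1 _ (fun _ => f) total_recursive_succ.
by move=> /(_ (fun _ => hf)); apply: total_recursive_ext => v /=; rewrite /thead tnth_mktuple.
Qed.

Lemma total_recursive_const (k c : nat) :
  total_recursive (fun _ : k.-tuple nat => c).
Proof.
elim: c => [|c ih].
  by apply: (@total_recursive_comp k 0 _ (fun _ _ => 0%N) total_recursive_zero);
    case.
exact: total_recursive_comp1.
Qed.

Lemma total_recursive_comp2 (op : nat -> nat -> nat) (k : nat)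
    (f g : k.-tuple nat -> nat) :
  total_recursive (fun w : 2.-tuple nat => op (tnth w ord0) (tnth w ord_max)) ->
  total_recursive f -> total_recursive g ->
  total_recursive (fun v => op (f v) (g v)).
Proof.
move=> hop hf hg.
have := @total_recursive_comp k 2 _ (fun i => if i == ord0 then f else g) hop.
have hi (i : 'I_2) : total_recursive (if i == ord0 then f else g) by case: ifP.
by move=> /(_ hi); apply: total_recursive_ext => v; rewrite !tnth_mktuple.
Qed.

Lemma total_recursive_add (k : nat) (f g : k.-tuple nat -> nat) :
  total_recursive f -> total_recursive g ->
  total_recursive (fun v => f v + g v)%N.
Proof.
apply: total_recursive_comp2.
apply: (@total_recursive_prim 1 (fun v => tnth v ord0)
  (fun w => (tnth w (inord 1)).+1)).
- exact: total_recursive_proj.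
- exact/total_recursive_comp1/total_recursive_proj.
- by move=> v; rewrite !(tnth_nth 0%N) /= add0n.
- by move=> n v; rewrite !(tnth_nth 0%N) /= inordK.
Qed.

Lemma total_recursive_mul (k : nat) (f g : k.-tuple nat -> nat) :
  total_recursive f -> total_recursive g ->
  total_recursive (fun v => f v * g v)%N.
Proof.
apply: total_recursive_comp2.
apply: (@total_recursive_prim 1 (fun v => 0%N)
  (fun w => tnth w (inord 1) + tnth w (inord 2))%N).
- exact: total_recursive_const.
- by apply: total_recursive_add; exact: total_recursive_proj.
- by move=> v; rewrite !(tnth_nth 0%N).
- by move=> n v; rewrite !(tnth_nth 0%N) /= !inordK//= mulSn addnC.
Qed.

Lemma total_recursive_exp (k n : nat) (f : k.-tuple nat -> nat) :
  total_recursive f -> total_recursive (fun v => f v ^ n)%N.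
Proof.
move=> hf; elim: n => [|n ih]; first exact: total_recursive_const.
apply: total_recursive_ext (total_recursive_mul hf ih) => v.
by rewrite expnS.
Qed.

(** The approximation of precision [1 / (k + 1)] has numerator [C b * (k + 1)]. *)
Lemma effective_nat (R : realType) (C : nat -> nat) :
  total_recursive (fun v : 2.-tuple nat => C (tnth v ord0)) ->
  effective (fun b => (C b)%:R : R).
Proof.
move=> hC.
exists (fun v => C (tnth v ord0) * (tnth v ord_max).+1)%N, (fun=> 0%N); split.
- apply: total_recursive_mul => //.
  exact/total_recursive_comp1/total_recursive_proj.
- exact: total_recursive_const.
move=> b k; rewrite !(tnth_nth 0%N) /= subr0 natrM mulfK ?pnatr_eq0//.
by rewrite subrr normr0 invr_ge0.
Qed.

(** * The theorem *)

Lemma exists_minimum (R : realType) (P : set nat) (f : nat -> R) (N n : nat) :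
  (forall k, P k -> (k <= N)%N) -> P n ->
  exists2 m, is_minimum [set f k | k in P] m & m <= f n.
Proof.
move=> PN Pn; have nN : (n < N.+1)%N by rewrite ltnS PN.
have Pn' : `[< P (Ordinal nN) >] by apply/asboolP.
case: (@arg_minP _ _ _ (Ordinal nN) (fun i : 'I_N.+1 => `[< P i >]) f Pn').
move=> i /asboolP Pi fi; exists (f i); last exact: fi (Ordinal nN) Pn'.
split; first by exists i.
move=> _ [k Pk <-]; have kN : (k < N.+1)%N by rewrite ltnS PN.
exact: fi (Ordinal kN) (asboolT Pk).
Qed.

Theorem theorem1p1 (R : realType) :
  exists C : nat -> R, effective C /\
    forall b : nat, (2 <= b)%N ->
    forall (gamma : R) (N : nat), (2 <= N)%N ->
    exists2 m : R,
      is_minimum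
        [set dist_int (gamma * n%:R) | n in
           [set n : nat | (1 <= n <= N)%N /\ binary_digits b n]] m
      & m <= C b / (ln N%:R) ^+ 2.
Proof.
(* With [t] maximal such that [b ^ ((72 b ^ 2 t) ^ 3) <= N], precision
   [2 ^- (6 t)] is reached; since [t + 1 <= 2 ^ t], the logarithm of [N] is
   at most [(72 b ^ 3 2 ^ t) ^ 3], whose square is the constant times
   [2 ^ (6 t)]. *)
exists (fun b => ((72 * b ^ 3) ^ 6)%:R); split.
  apply: effective_nat; apply: total_recursive_exp; apply: total_recursive_mul.
    exact: total_recursive_const.
  exact/total_recursive_exp/total_recursive_proj.
move=> b b2 gamma N N2.
have [t tN Nt] : exists2 t : nat, (b ^ ((72 * b ^ 2 * t) ^ 3) <= N)%N
    & (N < b ^ ((72 * b ^ 2 * t.+1) ^ 3))%N.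
  have ex0 : exists t, (b ^ ((72 * b ^ 2 * t) ^ 3) <= N)%N.
    by exists 0%N; rewrite muln0 expn0; lia.
  have bnd t : (b ^ ((72 * b ^ 2 * t) ^ 3) <= N)%N -> (t <= N)%N.
    apply: leq_trans; apply: ltnW.
    apply: leq_ltn_trans (_ : (72 * b ^ 2 * t) ^ 3 < _)%N; last exact: ltn_expl.
    have [->//|t0] := posnP t.
    have tc : (t <= 72 * b ^ 2 * t)%N by rewrite leq_pmull//; nia.
    by apply: (leq_trans tc); rewrite -[leqLHS]expn1 leq_pexp2l// (leq_trans t0).
  have [t tN max] := ex_maxnP ex0 bnd; exists t => //.
  by rewrite ltnNge; apply/negP => /max; rewrite ltnn.
have [n [nb nlt nd]] := exists_digits_small (6 * t) gamma b2.
have nN : (n <= N)%N.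
  apply: leq_trans nlt (leq_trans _ tN).
  by rewrite (_ : 12 * b ^ 2 * (6 * t) = 72 * b ^ 2 * t)%N//; lia.
have [||m mmin mle] := @exists_minimum R
    [set n : nat | (1 <= n <= N)%N /\ binary_digits b n]
    (fun n => dist_int (gamma * n%:R)) N n.
- by move=> k [/andP[]].
- by split=> //; rewrite nN andbT (binary_digits_gt0 _ nb)//; lia.
exists m => //; apply: le_trans mle (le_trans nd _).
have N1 : (1 : R) < N%:R by rewrite ltr1n.
have lnN0 : 0 < ln (N%:R : R) by exact: ln_gt0.
have b0 : (0 : R) < b%:R by rewrite ltr0n; lia.
have lnN : ln (N%:R : R) <= ((72 * b ^ 3 * 2 ^ t) ^ 3)%:R.
  apply: le_trans (_ : ln ((b%:R : R) ^+ ((72 * b ^ 2 * t.+1) ^ 3)) <= _).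
    rewrite ler_ln ?posrE ?exprn_gt0//; last by lra.
    by rewrite -natrX ler_nat ltnW.
  rewrite lnXn// -[leLHS]mulr_natl.
  apply: le_trans (_ : ((72 * b ^ 2 * t.+1) ^ 3)%:R * b%:R <= _).
    by apply: ler_wpM2l => //; apply/ltW/ln_sublinear.
  rewrite -natrM ler_nat.
  apply: leq_trans (_ : (72 * b ^ 2 * t.+1) ^ 3 * b ^ 3 <= _)%N.
    by rewrite leq_mul2l -[leqLHS]expn1 leq_pexp2l ?orbT//; lia.
  rewrite -expnMn leq_exp2r//.
  have : (t.+1 <= 2 ^ t)%N by exact: ltn_expl.
  move=> ht; rewrite -mulnA [(_ * b)%N]mulnC mulnA -[in leqRHS]mulnA.
  rewrite (_ : 72 * b ^ 2 * b = 72 * b ^ 3)%N; last by rewrite !expnS expn0; lia.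
  by rewrite mulnA leq_mul2l ht orbT.
rewrite ler_pdivlMr ?exprn_gt0// exprVn -natrX ler_pdivrMl ?ltr0n ?expn_gt0//.
rewrite -natrM; apply: le_trans (_ : ((72 * b ^ 3 * 2 ^ t) ^ 3)%:R ^+ 2 <= _).
  by apply: lerXn2r; rewrite ?nnegrE//; exact: ltW.
rewrite -natrX -expnM ler_nat expnMn mulnC -(expnM 2).
by rewrite [(t * _)%N]mulnC.
Qed.
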